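(* Let $\mathcal{M}_1=(V,\mathcal{I}_1)$ and $\mathcal{M}_2=(V,\mathcal{I}_2)$ be matroids on a common ground set $V$ with $n=|V|$, let $r$ be the size of a largest common independent set, and let $\epsilon>0$. Given a point $x\in\mathcal{P}_{\mathcal{M}_1}\cap\mathcal{P}_{\mathcal{M}_2}$ with $\|x\|_1\ge(1-\epsilon)r$, one can find in $O(n)$ time a set $V'\subseteq V$ of size $O\!\left(\frac{r}{\epsilon^{2}}\log n\right)$ such that the largest subset of $V'$ that is independent in both $\mathcal{M}_1$ and $\mathcal{M}_2$ has at least $(1-O(\epsilon))\cdot r$ elements.
   Context: A matroid $\mathcal{M}=(V,\mathcal{I})$ is a finite ground set with a family of independent sets containing $\emptyset$, closed under subsets, satisfying the exchange property. The matroid polytope $\mathcal{P}_{\mathcal{M}}\subseteq\mathbb{R}^V$ is the convex hull of the indicator vectors of the independent sets of $\mathcal{M}$. (The procedure is randomized and its guarantees hold with high probability in $n$.) *)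

(* Defs.v *)
From HB Require Import structures.
From mathcomp Require Import all_boot all_order all_algebra.

Set Implicit Arguments.
Unset Strict Implicit.
Unset Printing Implicit Defensive.

Import Order.TTheory GRing.Theory Num.Theory.
Local Open Scope ring_scope.

Record matroid (V : finType) := Matroid {
  indep : {set {set V}};
  indep_set0 : set0 \in indep;
  indep_subset : forall A B : {set V},
    A \subset B -> B \in indep -> A \in indep;
  indep_exchange : forall A B : {set V},
    A \in indep -> B \in indep -> (#|A| < #|B|)%N ->
    exists2 v, v \in B :\: A & v |: A \in indep }.

(* Convex hull of the indicator vectors of the independent sets; these are
   finitely many points, so one weight per independent set is enough. *)
Definition matroid_polytope (R : realFieldType) (V : finType) (M : matroid V)
    (x : V -> R) : Prop :=
  exists w : {set V} -> R,
    [/\ forall A, A \in indep M -> 0 <= w A,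
        \sum_(A in indep M) w A = 1
      & forall v, x v = \sum_(A in indep M) w A * (v \in A)%:R].

Definition common_rank (V : finType) (M1 M2 : matroid V) (A : {set V}) : nat :=
  \max_(B : {set V} | [&& B \subset A, B \in indep M1 & B \in indep M2]) #|B|.

(* Randomized unit-cost real RAM.  A program is a finite text containing only
   natural-number literals, so it is uniform in the size and in the values of
   the input.  Registers are named statically; the two memories are accessed
   through addresses held in natural-number registers.  Natural numbers change
   only by successor and predecessor, so in t steps they grow by at most t
   beyond the input and the literals: cells hold O(log n)-bit words during a
   linear-time run.  Reals support field arithmetic and comparison only (no
   rounding, no conversion to naturals). *)
Inductive arith := Add | Sub | Mul | Div.

Inductive test :=
| NLt of nat & nat
| RLt of nat & nat.

Inductive cmd :=
| Skip
| NConst (a k : nat)             (* nreg a := k *)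
| NCopy (a b : nat)              (* nreg a := nreg b *)
| NSucc (a : nat)                (* nreg a := nreg a + 1 *)
| NPred (a : nat)                (* nreg a := nreg a - 1, truncated *)
| NLoad (a b : nat)              (* nreg a := nmem (nreg b) *)
| NStore (a b : nat)             (* nmem (nreg a) := nreg b *)
| RConst (a k : nat)             (* rreg a := k *)
| RCopy (a b : nat)              (* rreg a := rreg b *)
| RArith (o : arith) (a b c : nat) (* rreg a := rreg b o rreg c *)
| RLoad (a b : nat)              (* rreg a := rmem (nreg b) *)
| RStore (a b : nat)             (* rmem (nreg a) := rreg b *)
| Flip (a b : nat)               (* nreg a := 1 if U < rreg b and 0 otherwise,
                                    for a fresh uniform U in [0, 1] *)
| Seq (c1 c2 : cmd)
| If (t : test) (c1 c2 : cmd)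
| While (t : test) (c : cmd).

Record state (R : Type) := State {
  nreg : nat -> nat;
  rreg : nat -> R;
  nmem : nat -> nat;
  rmem : nat -> R }.

Section Semantics.
Variable R : realFieldType.
Implicit Types (s : state R) (k : seq cmd).

Definition set_nreg s a m :=
  State [eta nreg s with a |-> m] (rreg s) (nmem s) (rmem s).
Definition set_rreg s a y :=
  State (nreg s) [eta rreg s with a |-> y] (nmem s) (rmem s).
Definition set_nmem s a m :=
  State (nreg s) (rreg s) [eta nmem s with a |-> m] (rmem s).
Definition set_rmem s a y :=
  State (nreg s) (rreg s) (nmem s) [eta rmem s with a |-> y].

Definition eval_arith (o : arith) (y z : R) : R :=
  match o with
  | Add => y + z
  | Sub => y - z
  | Mul => y * z
  | Div => y / z
  end.

Definition eval_test s (t : test) : bool :=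
  match t with
  | NLt a b => (nreg s a < nreg s b)%N
  | RLt a b => rreg s a < rreg s b
  end.

(* P(U < y) for U uniform in [0, 1] *)
Definition clamp (y : R) : R := Num.max 0 (Num.min 1 y).

(* A configuration is a stack of commands still to be run with a state; a step
   returns the possible successor configurations with their probabilities. *)
Definition step (c : cmd) k s : seq (R * (seq cmd * state R)) :=
  match c with
  | Skip => [:: (1, (k, s))]
  | NConst a m => [:: (1, (k, set_nreg s a m))]
  | NCopy a b => [:: (1, (k, set_nreg s a (nreg s b)))]
  | NSucc a => [:: (1, (k, set_nreg s a (nreg s a).+1))]
  | NPred a => [:: (1, (k, set_nreg s a (nreg s a).-1))]
  | NLoad a b => [:: (1, (k, set_nreg s a (nmem s (nreg s b))))]
  | NStore a b => [:: (1, (k, set_nmem s (nreg s a) (nreg s b)))]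
  | RConst a m => [:: (1, (k, set_rreg s a m%:R))]
  | RCopy a b => [:: (1, (k, set_rreg s a (rreg s b)))]
  | RArith o a b b' =>
      [:: (1, (k, set_rreg s a (eval_arith o (rreg s b) (rreg s b'))))]
  | RLoad a b => [:: (1, (k, set_rreg s a (rmem s (nreg s b))))]
  | RStore a b => [:: (1, (k, set_rmem s (nreg s a) (rreg s b)))]
  | Flip a b => [:: (clamp (rreg s b), (k, set_nreg s a 1));
                    (1 - clamp (rreg s b), (k, set_nreg s a 0))]
  | Seq c1 c2 => [:: (1, ([:: c1, c2 & k], s))]
  | If t c1 c2 => [:: (1, ((if eval_test s t then c1 else c2) :: k, s))]
  | While t c1 =>
      [:: (1, (if eval_test s t then [:: c1, While t c1 & k] else k, s))]
  end.

(* Probability that the configuration (k, s) halts within t steps in a state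
   satisfying E. *)
Fixpoint halt_prob (t : nat) k s (E : pred (state R)) : R :=
  match k, t with
  | [::], _ => (E s)%:R
  | _ :: _, 0%N => 0
  | c :: k', t'.+1 =>
      \sum_(o <- step c k' s) o.1 * halt_prob t' o.2.1 o.2.2 E
  end.

(* The ground set is presented through the enumeration [enum V]: the i-th
   coordinate of x is in rmem i, the size of V in nreg 0 and eps in rreg 0. *)
Definition input (V : finType) (x : V -> R) (eps : R) : state R :=
  State [eta (fun=> 0%N) with 0%N |-> #|V|]
        [eta (fun=> 0) with 0%N |-> eps]
        (fun=> 0%N)
        (nth 0 [seq x v | v <- enum V]).

Definition output (V : finType) s : {set V} :=
  [set v : V | nmem s (enum_rank v) != 0%N].

End Semantics.

(* Main.v *)
(* Keep each element v independently with probability p_v = min(1, B x_v), where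
   B = c H_n / eps^2, and give a kept v the weight x_v / p_v, so that the weight
   y of the sample has mean x.  Since x(span I) <= |I| for every independent set
   I, a Chernoff bound gives y(span I) <= (1 + eps) |I| except with probability
   n^(-(d+4)|I|); as there are at most n^k sets I of size k, this holds for all
   I and for both matroids at once.  Every set T lies in the span of one of its
   bases, hence y(T) <= (1 + eps) r_i(T) for all T, and the matroid intersection
   theorem turns this into
     (1 + eps) (common rank of V') >= y(V') >= (1 - 2 eps) r.
   The same theorem gives x(V) <= r, which bounds the size of the sample. *)

Require Import Defs.
From HB Require Import structures.
From mathcomp Require Import all_boot all_order all_algebra.
From mathcomp Require Import sequences reals exp.
From mathcomp Require Import zify ring lra.

Set Implicit Arguments.
Unset Strict Implicit.
Unset Printing Implicit Defensive.

Import Order.TTheory GRing.Theory Num.Theory.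

(** * Matroid intersection *)

Section MatroidRank.
Variables (V : finType) (M : matroid V).
Implicit Types A B I J S T U W Z : {set V}.

Definition matroid_rank T : nat := \max_(A in indep M | A \subset T) #|A|.

Lemma matroid_rank_ge A T : A \in indep M -> A \subset T -> #|A| <= matroid_rank T.
Proof.
by move=> iA sAT; apply: (@leq_bigmax_cond _ _ (fun A : {set V} => #|A|)); rewrite iA.
Qed.

Lemma matroid_rank_le T k :
  (forall A, A \in indep M -> A \subset T -> #|A| <= k) -> matroid_rank T <= k.
Proof. by move=> h; apply/bigmax_leqP => A /andP[]; exact: h. Qed.

Lemma matroid_rank_basis T : exists A,
  [/\ A \in indep M, A \subset T & #|A| = matroid_rank T].
Proof.
have [|A /andP[iA sA] eA] :=
  @eq_bigmax_cond _ [pred A in indep M | A \subset T] (fun A => #|A|).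
  by apply/card_gt0P; exists set0; rewrite inE /= indep_set0 sub0set.
by exists A; split.
Qed.

(** A largest independent set between I and T already has full rank, since otherwise exchange with a
    basis of T would enlarge it. *)
Lemma matroid_rank_extend I T : I \in indep M -> I \subset T -> exists J,
  [/\ J \in indep M, I \subset J, J \subset T & #|J| = matroid_rank T].
Proof.
move=> iI sIT.
pose P J := [&& J \in indep M, I \subset J & J \subset T].
have PI : P I by rewrite /P iI sIT subxx.
case: (@arg_maxnP _ I P (fun A => #|A|) PI) => J /and3P[iJ sIJ sJT] maxJ.
exists J; split=> //; apply/eqP; rewrite eqn_leq matroid_rank_ge //= leqNgt.
apply/negP => ltJ.
have [B [iB sBT eB]] := matroid_rank_basis T.
have [|v] := indep_exchange iJ iB; first by rewrite eB.
rewrite inE => /andP[vJ vB] ivJ.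
have : P (v |: J).
  by rewrite /P ivJ (subset_trans sIJ (subsetUr _ _)) subUset sub1set (subsetP sBT) //.
by move=> /maxJ; rewrite cardsU1 vJ /= add1n ltnn.
Qed.

(** Extend a basis I of the intersection to a basis J of the union. Then J meets A and B in
    independent sets whose sizes add up to |J| plus the size of a set containing I. *)
Lemma matroid_rank_submod A B :
  matroid_rank (A :|: B) + matroid_rank (A :&: B) <= matroid_rank A + matroid_rank B.
Proof.
have [I [iI sI <-]] := matroid_rank_basis (A :&: B).
have sIU : I \subset A :|: B.
  by apply: subset_trans sI _; apply: subset_trans (subsetIl _ _) (subsetUl _ _).
have [J [iJ sIJ sJ <-]] := matroid_rank_extend iI sIU.
have h C : #|J :&: C| <= matroid_rank C.
  apply: matroid_rank_ge; last exact: subsetIr.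
  by apply: indep_subset iJ; exact: subsetIl.
apply: leq_trans (leq_add (h A) (h B)).
rewrite -(cardsUI (J :&: A)) -setIUr (setIidPl sJ) leq_add2l subset_leq_card //.
by rewrite setIACA setIid subsetI sIJ.
Qed.

Lemma matroid_rank_indepU Z T : Z \in indep M ->
  (forall v, v \in T -> v |: Z \in indep M -> v \in Z) ->
  matroid_rank (T :|: Z) <= #|Z|.
Proof.
move=> iZ h; apply: matroid_rank_le => A iA sA; rewrite leqNgt; apply/negP => lt.
have [v] := indep_exchange iZ iA lt.
rewrite inE => /andP[vZ vA] ivZ.
have := subsetP sA v vA; rewrite inE (negPf vZ) orbF => /h /(_ ivZ).
by rewrite (negPf vZ).
Qed.

(** This is the closure of I only when I is independent; for a dependent I it is all of V. *)
Definition matroid_span I := [set v | (v \in I) || (v |: I \notin indep M)].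

(** Were the intersection larger than I, exchange would add one of its elements to I, which
    membership in the span forbids. *)
Lemma card_indep_span I A : I \in indep M -> A \in indep M -> #|A :&: matroid_span I| <= #|I|.
Proof.
move=> iI iA; rewrite leqNgt; apply/negP => lt.
have iAI : A :&: matroid_span I \in indep M by apply: indep_subset iA; exact: subsetIl.
have [v] := indep_exchange iI iAI lt.
by rewrite !inE => /andP[/negPf-> /andP[_ /negPf->]].
Qed.

Lemma sub_span_basis T : exists I,
  [/\ I \in indep M, #|I| = matroid_rank T & T \subset matroid_span I].
Proof.
have [I [iI sI eI]] := matroid_rank_basis T.
exists I; split=> //; apply/subsetP => v vT; rewrite inE.
have [//|vI] := boolP (v \in I) => /=; apply/negP => ivI.
have : #|v |: I| <= matroid_rank T.
  by apply: matroid_rank_ge; rewrite // subUset sub1set vT.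
by rewrite cardsU1 vI -eI /= add1n ltnn.
Qed.

End MatroidRank.

(* The contraction by Z and the restriction to W are carried along explicitly. *)
Lemma matroid_intersection_contract (V : finType) (M1 M2 : matroid V)
    (W Z : {set V}) :
  Z \in indep M1 -> Z \in indep M2 -> [disjoint W & Z] ->
  exists B U : {set V},
  [/\ B \subset W, U \subset W, B :|: Z \in indep M1, B :|: Z \in indep M2
    & matroid_rank M1 (U :|: Z) + matroid_rank M2 ((W :\: U) :|: Z)
        <= #|B| + 2 * #|Z|].
Proof.
have [m] := ubnP #|W|; elim: m => // m IHm in W Z *; rewrite ltnS => leW iZ1 iZ2 dWZ.
have [/existsP[e /and3P[eW ie1 ie2]]|none] :=
    boolP [exists e, [&& e \in W, e |: Z \in indep M1 & e |: Z \in indep M2]]; last first.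
  (* No element of W extends Z in both matroids. U collects those blocked in [M1]; the others are
     blocked in [M2], so both ranks are at most |Z|. *)
  exists set0, [set e in W | e |: Z \notin indep M1].
  rewrite !set0U; split=> //; first exact: sub0set.
    by apply/subsetP => v; rewrite inE => /andP[].
  rewrite cards0 add0n mul2n -addnn leq_add //; apply: matroid_rank_indepU => // v.
    by rewrite inE => /andP[_ /negPf->].
  rewrite !inE negb_and negbK => /andP[/orP[/negPf->//|iv1] vW] iv2.
  by case/existsP: none; exists v; rewrite vW iv1.
have eZ : e \notin Z by rewrite (disjointFr dWZ eW).
have leWe : #|W :\ e| < m by move: leW; rewrite (cardsD1 e) eW.
have dWe : [disjoint W :\ e & Z] by apply: disjointWl dWZ; exact: subsetDl.
have dWe' : [disjoint W :\ e & e |: Z].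
  apply/pred0P => v; have := pred0P dWe v; rewrite /= !inE.
  by case: eqVneq.
(* Induct twice on W without e: once with e deleted, once with e contracted into Z. *)
have [B1 [A [sB1 sA iB11 iB12 leA]]] := IHm _ _ leWe iZ1 iZ2 dWe.
have [B2 [C [sB2 sC iB21 iB22 leC]]] := IHm _ _ leWe ie1 ie2 dWe'.
have eB2 : e \notin B2 by apply/negP => /(subsetP sB2); rewrite !inE eqxx.
pose k := maxn #|B1| #|B2|.+1.
have [B [sB iB1 iB2 eB]] : exists B : {set V}, [/\ B \subset W,
    B :|: Z \in indep M1, B :|: Z \in indep M2 & #|B| = k].
  rewrite /k /maxn; case: ltnP => _.
    exists (e |: B2); rewrite cardsU1 eB2 -setUA setUCA; split=> //.
    by rewrite subUset sub1set eW (subset_trans sB2 (subsetDl _ _)).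
  by exists B1; split=> //; apply: subset_trans sB1 (subsetDl _ _).
have sAW : A \subset W := subset_trans sA (subsetDl _ _).
have sCW : C \subset W := subset_trans sC (subsetDl _ _).
have [eA eC] : e \notin A /\ e \notin C.
  by split; apply/negP; [move/(subsetP sA)|move/(subsetP sC)]; rewrite !inE eqxx.
(* Uncrossing: by submodularity of both ranks, the values at P and Q sum to at most twice the target
   plus one, so by integrality one of them meets the target. *)
pose P := A :&: C; pose Q := e |: (A :|: C).
suff: matroid_rank M1 (P :|: Z) + matroid_rank M2 ((W :\: P) :|: Z)
    + (matroid_rank M1 (Q :|: Z) + matroid_rank M2 ((W :\: Q) :|: Z))
    <= 2 * (#|B| + 2 * #|Z|) + 1.
  have aux p q c : c < p -> p + q <= 2 * c + 1 -> q <= c by clear; lia.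
  move=> le2.
  have [leP|ltP] := leqP (matroid_rank M1 (P :|: Z) +
      matroid_rank M2 ((W :\: P) :|: Z)) (#|B| + 2 * #|Z|).
    exists B, P; split=> //.
    by apply: subset_trans sAW; exact: subsetIl.
  exists B, Q; split=> //; last by apply: aux ltP le2.
  by rewrite !subUset sub1set eW sAW.
have := matroid_rank_submod M1 (A :|: Z) (C :|: (e |: Z)).
have := matroid_rank_submod M2 ((W :\ e :\: A) :|: Z) ((W :\ e :\: C) :|: (e |: Z)).
have -> : (A :|: Z) :|: (C :|: (e |: Z)) = Q :|: Z.
  by apply/setP => v; rewrite !inE; do !case: (_ \in _) => //; case: (_ == _).
have -> : (A :|: Z) :&: (C :|: (e |: Z)) = P :|: Z.
  apply/setP => v; rewrite !inE; case: eqVneq => [->|_].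
    by rewrite (negPf eA) /= (negPf eZ).
  by do !case: (_ \in _).
have -> : ((W :\ e :\: A) :|: Z) :|: ((W :\ e :\: C) :|: (e |: Z)) = (W :\: P) :|: Z.
  apply/setP => v; rewrite !inE; case: eqVneq => [->|_].
    by rewrite (negPf eA) eW /= !orbT.
  by do !case: (_ \in _).
have -> : ((W :\ e :\: A) :|: Z) :&: ((W :\ e :\: C) :|: (e |: Z)) = (W :\: Q) :|: Z.
  apply/setP => v; rewrite !inE; case: eqVneq => [->|_].
    by rewrite /= !andbF /= (negPf eZ).
  by do !case: (_ \in _).
have aux p q p' q' a b a' b' b1 b2 z : a + b <= b1 + 2 * z ->
    a' + b' <= b2 + 2 * (true + z) -> p + q <= b + b' -> q' + p' <= a + a' ->
    p' + p + (q' + q) <= 2 * (maxn b1 b2.+1 + 2 * z) + 1.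
  by clear; lia.
by move=> le2 le1; rewrite eB /k; apply: aux leA _ le2 le1; move: leC; rewrite cardsU1 eZ.
Qed.

Lemma leq_common_rank (V : finType) (M1 M2 : matroid V) (W B : {set V}) :
  B \subset W -> B \in indep M1 -> B \in indep M2 -> #|B| <= common_rank M1 M2 W.
Proof.
by move=> sB iB1 iB2; apply: (@leq_bigmax_cond _ _ (fun B : {set V} => #|B|)); rewrite sB iB1.
Qed.

(** The hard direction of the min-max formula: nothing is contracted at the start. *)
Lemma matroid_intersection (V : finType) (M1 M2 : matroid V) (W : {set V}) :
  exists2 U : {set V}, U \subset W &
  matroid_rank M1 U + matroid_rank M2 (W :\: U) <= common_rank M1 M2 W.
Proof.
have d0 : [disjoint W & set0] by rewrite -setI_eq0 setI0.
have [B [U []]] :=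
  matroid_intersection_contract (indep_set0 M1) (indep_set0 M2) d0.
rewrite !setU0 cards0 muln0 addn0 => sB sU iB1 iB2 leU.
exists U => //; apply: leq_trans leU _; exact: leq_common_rank.
Qed.

Local Open Scope ring_scope.

(** * Independent sampling *)

Lemma ler_nat_bool (R : numDomainType) (b1 b2 : bool) :
  (b1 -> b2) -> b1%:R <= b2%:R :> R.
Proof. by rewrite ler_nat; case: b1 => [->|]. Qed.

Section SampleMean.
Variables (R : realFieldType) (V : finType) (p : V -> R).
Implicit Types (l : seq V) (F G : {set V} -> R) (S : {set V}).

(** Expectation as a binary tree of coin flips, with S accumulating the kept elements. The recursion
    mirrors the sampling loop of the program, so no probability space is needed. *)
Fixpoint sample_mean l F S : R :=
  if l is v :: l' then
    p v * sample_mean l' F (v |: S) + (1 - p v) * sample_mean l' F S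
  else F S.

Lemma sample_mean_const l (c : R) S : sample_mean l (fun=> c) S = c.
Proof. by elim: l S => //= v l IH S; rewrite !IH; ring. Qed.

Lemma sample_meanD l F G S :
  sample_mean l (fun S => F S + G S) S = sample_mean l F S + sample_mean l G S.
Proof. by elim: l S => //= v l IH S; rewrite !IH; ring. Qed.

Lemma sample_meanZ l (c : R) F S :
  sample_mean l (fun S => c * F S) S = c * sample_mean l F S.
Proof. by elim: l S => //= v l IH S; rewrite !IH; ring. Qed.

Lemma sample_mean_sum (I : finType) (P : pred I) (F : I -> {set V} -> R) l S :
  sample_mean l (fun S => \sum_(i | P i) F i S) S
  = \sum_(i | P i) sample_mean l (F i) S.
Proof.
elim: l S => //= v l IH S; rewrite !IH !mulr_sumr -big_split.
by apply: eq_bigr.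
Qed.

Lemma sample_mean_eq0 l F S : (forall v, p v = 0) -> sample_mean l F S = F S.
Proof. by move=> p0; elim: l => //= v l IH; rewrite p0 IH; ring. Qed.

Hypothesis p_itv : forall v, 0 <= p v <= 1.

Lemma ler_sample_mean l F G S :
  (forall S, F S <= G S) -> sample_mean l F S <= sample_mean l G S.
Proof.
move=> leFG; elim: l S => //= v l IH S; have /andP[p0 p1] := p_itv v.
by rewrite lerD // ler_wpM2l // subr_ge0.
Qed.

End SampleMean.

(** * Exponential moments of an independent sample *)

Section Chernoff.
Variables (R : realType) (V : finType) (p : V -> R).
Implicit Types (l : seq V) (a b : V -> R) (S : {set V}).

(** Independence turns the exponential moment into a product; freshness of the elements of l ensures
    that each kept v contributes [a v] exactly once. *)
Lemma sample_mean_expR l a S : uniq l -> (forall v, v \in l -> v \notin S) ->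
  sample_mean p l (fun S => expR (\sum_(v in S) a v)) S
  = expR (\sum_(v in S) a v) * \prod_(v <- l) (1 - p v + p v * expR (a v)).
Proof.
elim: l S => [|v l IH] S /=; first by rewrite big_nil mulr1.
move=> /andP[vl ul] lS; rewrite big_cons.
have vS : v \notin S by apply: lS; rewrite mem_head.
rewrite !IH //; last first.
- move=> w wl; rewrite !inE negb_or lS ?inE ?wl ?orbT // andbT.
  by apply: contraNneq vl => <-.
- by move=> w wl; rewrite lS // inE wl orbT.
by rewrite big_setU1 //= expRD; ring.
Qed.

Hypothesis p_itv : forall v, 0 <= p v <= 1.

(** Markov's inequality for the exponential moment, with [b v] majorizing the logarithm of the
    factor of v. *)
Lemma chernoff a b (c : R) :
  (forall v, 1 - p v + p v * expR (a v) <= expR (b v)) ->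
  sample_mean p (enum V) (fun S => (c <= \sum_(v in S) a v)%R%:R) set0
  <= expR (\sum_v b v - c).
Proof.
move=> hab.
apply: (@le_trans _ _ (sample_mean p (enum V)
    (fun S => expR (- c) * expR (\sum_(v in S) a v)) set0)).
  apply: ler_sample_mean => // S; rewrite -expRD.
  case: (lerP c) => [le|_]; last exact: expR_ge0.
  rewrite -[true%:R]expR0 ler_expR.
  by rewrite addrC subr_ge0.
rewrite sample_meanZ sample_mean_expR ?enum_uniq //; last by move=> v; rewrite inE.
rewrite big_set0 expR0 mul1r addrC expRD ler_wpM2l ?expR_ge0 // expR_sum.
rewrite big_enum /=; apply: ler_prod => v _; rewrite hab andbT.
have /andP[p0 p1] := p_itv v.
by rewrite addr_ge0 ?subr_ge0 // mulr_ge0 // expR_ge0.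
Qed.

End Chernoff.

(** * Linear bounds on the matroid polytope *)

Section Polytope.
Variables (R : realFieldType) (V : finType) (M : matroid V) (x : V -> R).
Hypothesis xM : matroid_polytope M x.

Lemma matroid_polytope_ge0 v : 0 <= x v.
Proof.
have [w [w0 _ ->]] := xM.
by apply: sumr_ge0 => A iA; rewrite mulr_ge0 ?w0 // ler0n.
Qed.

(** A linear bound on a convex hull need only be checked at the generating points. *)
Lemma matroid_polytope_sum_le (T : {set V}) k :
  (forall A, A \in indep M -> #|A :&: T| <= k)%N -> \sum_(v in T) x v <= k%:R.
Proof.
move=> hk; have [w [w0 w1 xE]] := xM.
under eq_bigr do rewrite xE.
have -> : k%:R = \sum_(A in indep M) w A * k%:R by rewrite -mulr_suml w1 mul1r.
rewrite exchange_big /=.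
apply: ler_sum => A iA; rewrite -mulr_sumr ler_wpM2l ?w0 //.
rewrite -natr_sum ler_nat (leq_trans _ (hk A iA)) // setIC -sum1_card.
rewrite big_mkcond /= [leqRHS]big_mkcond /=; apply: leq_sum => v _.
by rewrite inE; case: (v \in T); case: (v \in A).
Qed.

Lemma matroid_polytope_sum_le_rank (T : {set V}) :
  \sum_(v in T) x v <= (matroid_rank M T)%:R.
Proof.
apply: matroid_polytope_sum_le => A iA; apply: matroid_rank_ge; last exact: subsetIr.
by apply: indep_subset iA; exact: subsetIl.
Qed.

End Polytope.

(** Split V at the set U of the min-max formula and bound the two parts by the rank in [M1] and in
    [M2]. *)
Lemma common_polytope_sum_le (R : realFieldType) (V : finType) (M1 M2 : matroid V)
    (x : V -> R) :
  matroid_polytope M1 x -> matroid_polytope M2 x ->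
  \sum_v x v <= (common_rank M1 M2 [set: V])%:R.
Proof.
move=> x1 x2; have [U _ leU] := matroid_intersection M1 M2 [set: V].
apply: (@le_trans _ _ (matroid_rank M1 U + matroid_rank M2 (~: U))%:R); last first.
  by rewrite ler_nat -setTD.
rewrite natrD (bigID (mem U)) /= lerD ?matroid_polytope_sum_le_rank //.
apply: le_trans (matroid_polytope_sum_le_rank x2 (~: U)).
by rewrite le_eqVlt; apply/orP; left; apply/eqP/eq_bigl => v; rewrite inE.
Qed.

(** * Tail bounds for inverse-probability weights *)

Section Tails.
Variables (R : realType).
Implicit Types (t u e : R).

(** Multiply by 1 - t <= exp(-t): the right side becomes 1 + t^2 (1 - 2t), which is at least 1 up to
    t = 1/2. *)
Lemma expR_le_quad t : 0 <= t <= 2^-1 -> expR t <= 1 + t + 2 * t ^+ 2.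
Proof.
move=> /andP[t0 t1]; have t1' : 0 < 1 - t by lra.
rewrite -(ler_pM2r t1').
apply: (@le_trans _ _ (expR t * expR (- t))).
  by rewrite ler_wpM2l ?expR_ge0 //; exact: expR_ge1Dx.
by rewrite expRxMexpNx_1; nra.
Qed.

Lemma expRN_le_quad t : 0 <= t -> expR (- t) <= 1 - t + t ^+ 2.
Proof.
move=> t0; have t1 : 0 < 1 + t by lra.
rewrite -(ler_pM2r t1).
apply: (@le_trans _ _ (expR (- t) * expR t)).
  by rewrite ler_wpM2l ?expR_ge0 //; exact: expR_ge1Dx.
rewrite mulrC expRxMexpNx_1; have : 0 <= t ^+ 3 by rewrite exprn_ge0.
by rewrite !exprS expr0; lra.
Qed.

Lemma clamp_itv u : 0 <= clamp u <= 1.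
Proof. by rewrite /clamp le_max lexx ge_max ler01 ge_min lexx. Qed.

Lemma clamp_le u : 0 <= u -> clamp u <= u.
Proof. by move=> u0; rewrite /clamp ge_max u0 ge_min lexx orbT. Qed.

(* Inverse-probability weighting, in units of the rate: [clamp u * weight u = u]. *)
Definition weight u : R := if u == 0 then 0 else Num.max u 1.

(** The right side is the moment generating function of a Poisson variable of mean u. For u <= 1 the
    weight is a Bernoulli variable; beyond 1 it is the constant u, so clamping does no harm. *)
Lemma weight_mgf t u : 0 <= u ->
  1 - clamp u + clamp u * expR (t * weight u) <= expR ((expR t - 1) * u).
Proof.
rewrite /weight /clamp; case: eqVneq => [-> _|u0 u_ge0].
  by rewrite min_r ?ler01 // maxxx !mulr0 expR0 mul0r addr0 subr0.
have [u1|u1] := lerP u 1.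
  rewrite max_r // mulr1; apply: le_trans (expR_ge1Dx _); lra.
rewrite max_r ?ler01 // subrr add0r mul1r ler_expR ler_wpM2r //.
by have := expR_ge1Dx t; lra.
Qed.

Variables (V : finType) (u : V -> R).
Hypothesis u_ge0 : forall v, 0 <= u v.
Let p v := clamp (u v).

Lemma weight_upper_tail (T : {set V}) (b e : R) : 0 < e <= 1 ->
  \sum_(v in T) u v <= b ->
  sample_mean p (enum V)
    (fun S => ((1 + e) * b <= \sum_(v in S :&: T) weight (u v))%R%:R) set0
  <= expR (- (b * (e ^+ 2 / 8))).
Proof.
(* This t minimizes 2 t^2 - t e, the coefficient of b left after the quadratic bound on exp; the
   minimum is -e^2/8. *)
move=> /andP[e0 e1] leb; set t := e / 4.
have t0 : 0 < t by rewrite /t; lra.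
pose a v := if v \in T then t * weight (u v) else 0.
pose c v := if v \in T then (expR t - 1) * u v else 0.
have p_itv v : 0 <= p v <= 1 by exact: clamp_itv.
have hac v : 1 - p v + p v * expR (a v) <= expR (c v).
  rewrite /a /c; case: ifP => _; first exact: weight_mgf.
  by rewrite !expR0 mulr1 subrK.
apply: (@le_trans _ _ (sample_mean p (enum V)
    (fun S => (t * ((1 + e) * b) <= \sum_(v in S) a v)%R%:R) set0)).
  apply: ler_sample_mean => // S; apply: ler_nat_bool => le.
  rewrite /a -big_mkcondr /= -mulr_sumr ler_wpM2l ?(ltW t0) //.
  apply: le_trans le _; rewrite (eq_bigl _ _ (fun v => in_setI v S T)).
  exact: lexx.
apply: le_trans (chernoff p_itv _ hac) _; rewrite ler_expR.
rewrite /c -big_mkcond /= -mulr_sumr.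
have E0 : 0 <= expR t - 1 by have := expR_ge1Dx t; lra.
apply: (@le_trans _ _ ((expR t - 1) * b - t * ((1 + e) * b))).
  by rewrite lerB // ler_wpM2l.
have b0 : 0 <= b by apply: le_trans leb; exact: sumr_ge0.
rewrite (_ : _ - _ = b * ((expR t - 1) - t * (1 + e))); last by ring.
rewrite -[leRHS]mulrN ler_wpM2l //.
have le4 : expR t <= 1 + t + 2 * t ^+ 2 by apply: expR_le_quad; rewrite /t; lra.
by rewrite /t in le4 *; lra.
Qed.

Lemma weight_lower_tail (b e : R) : 0 <= e <= 1 ->
  (1 - e) * b <= \sum_v u v <= b ->
  sample_mean p (enum V)
    (fun S => (\sum_(v in S) weight (u v) <= (1 - 2 * e) * b)%R%:R) set0
  <= expR (- (b * (e ^+ 2 / 4))).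
Proof.
(* With t = e/2 the exponent is at most b (t^2 - t e - t^2 e) = -b (e^2 + e^3)/4, and the cubic term
   is dropped. *)
move=> /andP[e0 e1] /andP[leb geb]; set t := e / 2.
have t0 : 0 <= t by rewrite /t; lra.
have p_itv v : 0 <= p v <= 1 by exact: clamp_itv.
have hac v : 1 - p v + p v * expR (- t * weight (u v)) <= expR ((expR (- t) - 1) * u v).
  exact: weight_mgf.
apply: (@le_trans _ _ (sample_mean p (enum V)
    (fun S => (- t * ((1 - 2 * e) * b) <= \sum_(v in S) - t * weight (u v))%R%:R) set0)).
  apply: ler_sample_mean => // S; apply: ler_nat_bool => le.
  by rewrite -mulr_sumr !mulNr lerN2 ler_wpM2l.
apply: le_trans (chernoff p_itv _ hac) _; rewrite ler_expR -mulr_sumr.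
have le2 := expRN_le_quad t0.
have b0 : 0 <= b by apply: le_trans geb; exact: sumr_ge0.
apply: (@le_trans _ _ ((- t + t ^+ 2) * ((1 - e) * b) + t * ((1 - 2 * e) * b))).
  rewrite mulNr opprK lerD2r.
  apply: (@le_trans _ _ ((- t + t ^+ 2) * \sum_v u v)).
    by rewrite ler_wpM2r ?sumr_ge0 //; lra.
  rewrite ler_wnM2l // /t; nra.
rewrite /t; have : 0 <= b * e ^+ 3 by rewrite mulr_ge0 ?exprn_ge0.
nra.
Qed.

Lemma card_tail (b : R) : \sum_v u v <= b ->
  sample_mean p (enum V) (fun S => (4 * b <= #|S|%:R)%R%:R) set0 <= expR (- b).
Proof.
move=> leb.
have p_itv v : 0 <= p v <= 1 by exact: clamp_itv.
(* With exponent 1/2 per element, each factor is at most 1 + p <= exp(u), and the threshold 4b costs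
   exp(-2b). *)
have E2 : expR 2^-1 <= 2 :> R.
  have := @expR_le_quad 2^-1; lra.
have hac v : 1 - p v + p v * expR 2^-1 <= expR (u v).
  apply: le_trans (expR_ge1Dx _).
  have := clamp_le (u_ge0 v); have /andP[] := p_itv v; rewrite /p; nra.
apply: (@le_trans _ _ (sample_mean p (enum V)
    (fun S => (2 * b <= \sum_(v in S) 2^-1)%R%:R) set0)).
  apply: ler_sample_mean => // S; apply: ler_nat_bool.
  by rewrite sumr_const -mulr_natr => le; lra.
apply: le_trans (chernoff p_itv _ hac) _; rewrite ler_expR; lra.
Qed.

End Tails.

(** * The sampled set *)

(** Expand the product of |V| factors z + 1. This evaluates the union bound over all sets I when
    each fails with probability at most z^|I|. *)
Lemma sum_expr_card (R : comRingType) (V : finType) (z : R) :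
  \sum_(A : {set V}) z ^+ #|A| = (1 + z) ^+ #|V|.
Proof.
rewrite addrC -prodr_const (bigA_distr _ _ (fun=> z) (fun=> 1)) /=.
apply: eq_bigr => A _; rewrite -big_mkcond /= prodr_const //.
Qed.

(** Apply the min-max formula inside S: both parts lie in spans of their bases. Hence only spans of
    independent sets have to be controlled. *)
Lemma common_rank_of_span_le (R : realFieldType) (V : finType) (M1 M2 : matroid V)
    (y : V -> R) (c : R) (S : {set V}) : 0 < c -> (forall v, 0 <= y v) ->
  (forall M I, M = M1 \/ M = M2 -> I \in indep M ->
     \sum_(v in S :&: matroid_span M I) y v <= c * #|I|%:R) ->
  \sum_(v in S) y v <= c * (common_rank M1 M2 S)%:R.
Proof.
move=> c0 y0 hspan; have [U sU leU] := matroid_intersection M1 M2 S.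
have rank_le M (T : {set V}) : M = M1 \/ M = M2 -> T \subset S ->
    \sum_(v in T) y v <= c * (matroid_rank M T)%:R.
  move=> hM sT; have [I [iI <- sTI]] := sub_span_basis M T.
  apply: le_trans (hspan M I hM iI).
  rewrite [leRHS](big_setID T) /= (setIidPr _); last by rewrite subsetI sT.
  by rewrite lerDl sumr_ge0.
apply: (@le_trans _ _ (c * (matroid_rank M1 U + matroid_rank M2 (S :\: U))%:R)).
  rewrite natrD mulrDr (big_setID U) /= (setIidPr sU).
  by rewrite lerD ?rank_le ?subsetDl //; [left|right].
by rewrite ler_wpM2l ?ler_nat // ltW.
Qed.

Lemma ler1B_indicator (R : numDomainType) (b : bool) (x : R) :
  0 <= x -> (~~ b -> 1 <= x) -> 1 - x <= b%:R.
Proof.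
by case: b => /= x0 h; [rewrite lerBlDr lerDl | rewrite subr_le0 h].
Qed.

Section SparsifiedIntersection.
Variables (R : realType) (d : nat) (V : finType) (M1 M2 : matroid V).
Variables (eps B : R) (x : V -> R).
Let n := #|V|.
Let r := common_rank M1 M2 [set: V].
Hypotheses (n_gt1 : (1 < n)%N) (eps_itv : 0 < eps <= 1) (B_gt0 : 0 < B).
Hypotheses (x1 : matroid_polytope M1 x) (x2 : matroid_polytope M2 x).
Hypothesis x_large : (1 - eps) * r%:R <= \sum_v x v.
Hypothesis B_large : n%:R ^+ (d + 4) <= expR (B * (eps ^+ 2 / 8)).

Let u v := B * x v.
Let p v := clamp (u v).
Let q := expR (- (B * (eps ^+ 2 / 8))).

Definition good_sample (S : {set V}) : bool :=
  (#|S|%:R <= 4 * (B * r%:R)) && ((1 - 3 * eps) * r%:R <= (common_rank M1 M2 S)%:R).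

Let x_ge0 v : 0 <= x v. Proof. exact: matroid_polytope_ge0 x1 v. Qed.
Let u_ge0 v : 0 <= u v. Proof. by rewrite mulr_ge0 // ltW. Qed.
Let p_itv v : 0 <= p v <= 1. Proof. exact: clamp_itv. Qed.
Let weight_ge0 v : 0 <= weight (u v).
Proof. by rewrite /weight; case: ifP => // _; rewrite le_max ler01 orbT. Qed.

Let bad_span M (S I : {set V}) :=
  ((1 + eps) * (B * #|I|%:R) <= \sum_(v in S :&: matroid_span M I) weight (u v))%R.

Lemma sum_rate_span M I : matroid_polytope M x -> I \in indep M ->
  \sum_(v in matroid_span M I) u v <= B * #|I|%:R.
Proof.
move=> xM iI; rewrite -mulr_sumr ler_wpM2l ?(ltW B_gt0) //.
by apply: (matroid_polytope_sum_le xM) => A iA; exact: card_indep_span.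
Qed.

Lemma bad_span_mean M I : matroid_polytope M x -> I \in indep M ->
  sample_mean p (enum V) (fun S => (bad_span M S I)%:R) set0 <= q ^+ #|I|.
Proof.
move=> xM iI; apply: le_trans (weight_upper_tail u_ge0 eps_itv (sum_rate_span xM iI)) _.
rewrite -expRM_natl ler_expR mulrN.
by have -> : B * #|I|%:R * (eps ^+ 2 / 8) = #|I|%:R * (B * (eps ^+ 2 / 8)) by ring.
Qed.

(** For I empty the tail bound q^0 = 1 says nothing. But x vanishes on loops, so their weight is 0
    for every sample. *)
Lemma span_set0_weight M (S : {set V}) : matroid_polytope M x ->
  \sum_(v in S :&: matroid_span M set0) weight (u v) = 0.
Proof.
move=> xM; apply: big1 => v; rewrite inE => /andP[_ vM].
have := sum_rate_span xM (indep_set0 M); rewrite cards0 mulr0 (bigD1 v) //= => le.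
have : u v <= 0 by apply: le_trans le; rewrite lerDl sumr_ge0.
move=> u0; have /eqP -> : u v == 0 by rewrite eq_le u0 u_ge0.
by rewrite /weight eqxx.
Qed.

Lemma good_sample_of_not_bad (S : {set V}) :
  ~~ (4 * (B * r%:R) <= #|S|%:R) ->
  ~~ (\sum_(v in S) weight (u v) <= (1 - 2 * eps) * (B * r%:R)) ->
  (forall I, I \in indep M1 -> I != set0 -> ~~ bad_span M1 S I) ->
  (forall I, I \in indep M2 -> I != set0 -> ~~ bad_span M2 S I) ->
  good_sample S.
Proof.
rewrite -!ltNge => ltS gtw h1 h2; rewrite /good_sample (ltW ltS) /=.
have /andP[e0 e1] := eps_itv.
have : \sum_(v in S) weight (u v) <= (1 + eps) * B * (common_rank M1 M2 S)%:R.
  apply: common_rank_of_span_le => //; first by rewrite mulr_gt0 //; lra.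
  move=> M I hM iI; have [->|I0] := eqVneq I set0.
    by rewrite span_set0_weight ?cards0 ?mulr0 //; case: hM => ->.
  rewrite -mulrA ltW // ltNge.
  by case: hM => hM; rewrite hM in iI *; [apply: h1 | apply: h2].
move=> le; have := lt_le_trans gtw le.
rewrite [X in X < _ -> _](_ : _ = (1 - 2 * eps) * r%:R * B); last by ring.
rewrite [X in _ < X -> _](_ : _ = (1 + eps) * (common_rank M1 M2 S)%:R * B); last by ring.
rewrite ltr_pM2r // => lt.
have e1' : 0 < 1 + eps by lra.
(* It remains that (1 + eps)(1 - 3 eps) = 1 - 2 eps - 3 eps^2 is at most 1 - 2 eps. *)
rewrite -(ler_pM2l e1'); apply: le_trans (ltW lt).
have : 0 <= r%:R * eps ^+ 2 by rewrite mulr_ge0 ?exprn_ge0 ?ler0n // ltW.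
by rewrite -subr_ge0 => h; rewrite -subr_ge0; nra.
Qed.

(** Of the four spare powers of n in q <= n^-(d+4), one pays for the factor n and three give n^-3 <=
    1/8, leaving room for all failure events. *)
Lemma nq_le : n%:R * q <= (n%:R ^+ d)^-1 / 8.
Proof.
have n0 : 0 < n%:R :> R by rewrite ltr0n ltnW.
have n2 : 2 <= n%:R :> R by rewrite ler_nat.
have : q <= (n%:R ^+ (d + 4))^-1.
  by rewrite /q expRN lef_pV2 // posrE ?expR_gt0 ?exprn_gt0.
move=> le; apply: (@le_trans _ _ (n%:R * (n%:R ^+ (d + 4))^-1)).
  by rewrite ler_wpM2l // ltW.
rewrite exprD invfM mulrCA ler_wpM2l ?invr_ge0 ?exprn_ge0 ?(ltW n0) //.
rewrite (exprS _ 3) invfM mulVKf ?lt0r_neq0 //.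
rewrite lef_pV2 ?posrE ?exprn_gt0 //.
have -> : 8 = 2 ^+ 3 :> R by ring.
by rewrite lerXn2r ?nnegrE // ltW.
Qed.

(** The union bound sums to (1 + q)^n - 1 <= exp(nq) - 1 <= nq + 2 (nq)^2, and nq <= 1/2. *)
Lemma bad_spans_mean M : matroid_polytope M x ->
  sample_mean p (enum V)
    (fun S => \sum_(I in indep M | I != set0) (bad_span M S I)%:R) set0
  <= 2 * (n%:R * q).
Proof.
move=> xM; rewrite sample_mean_sum.
apply: (@le_trans _ _ (\sum_(I : {set V} | I != set0) q ^+ #|I|)).
  rewrite big_mkcondl /=; apply: ler_sum => I _; case: ifP => iI.
    exact: bad_span_mean.
  by rewrite exprn_ge0 ?expR_ge0.
have := sum_expr_card V q; rewrite (bigD1 set0) //= cards0 expr0 -/n => eq.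
have q0 : 0 <= q := expR_ge0 _.
have le8 := nq_le.
have nq_half : n%:R * q <= 2^-1.
  have : (n%:R ^+ d)^-1 <= 1 :> R.
    by rewrite invf_le1 ?exprn_gt0 ?ltr0n ?exprn_ege1 ?ler1n // ltnW.
  lra.
have : (1 + q) ^+ n <= 1 + n%:R * q + 2 * (n%:R * q) ^+ 2.
  apply: (@le_trans _ _ (expR q ^+ n)).
    by rewrite lerXn2r ?nnegrE ?expR_ge0 ?expR_ge1Dx ?addr_ge0.
  rewrite -expRM_natl; apply: expR_le_quad.
  by rewrite nq_half mulr_ge0.
have : 0 <= n%:R * q by rewrite mulr_ge0.
move: eq nq_half; nra.
Qed.

Lemma sample_mean_good :
  1 - (n%:R ^+ d)^-1
  <= sample_mean p (enum V) (fun S => (good_sample S)%:R) set0.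
Proof.
have /andP[e0 e1] := eps_itv.
have le_r : \sum_v x v <= r%:R by exact: common_polytope_sum_le.
(* For r = 0 the tail bounds are trivial, but then x = 0 and the sample is surely empty. *)
have [r0|r0] := posnP r.
  have xE v : x v = 0.
    apply/le_anti; rewrite x_ge0 andbT; apply: le_trans (_ : \sum_v x v <= 0).
      by rewrite (bigD1 v) //= lerDl sumr_ge0.
    by rewrite (le_trans le_r) // r0.
  rewrite sample_mean_eq0; last first.
    by move=> v; rewrite /p /u xE mulr0 /clamp min_r ?ler01 // maxxx.
  rewrite /good_sample r0 cards0 !mulr0 lexx ler0n /=.
  by rewrite lerBlDr lerDl invr_ge0 exprn_ge0.
pose F1 (S : {set V}) : R := (4 * (B * r%:R) <= #|S|%:R :> R)%R%:R.
pose F2 (S : {set V}) : R := (\sum_(v in S) weight (u v) <= (1 - 2 * eps) * (B * r%:R))%R%:R.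
pose F3 M S : R := \sum_(I in indep M | I != set0) (bad_span M S I)%:R.
(* The union bound in pointwise form: F counts the bad events, so 1 - F is at most the indicator of
   a good sample. *)
pose F S := F1 S + F2 S + (F3 M1 S + F3 M2 S).
have F3_ge0 M S : 0 <= F3 M S by apply: sumr_ge0.
have F3_ge1 M S I : I \in indep M -> I != set0 -> bad_span M S I -> 1 <= F3 M S.
  move=> iI I0 b; rewrite /F3 (bigD1 I) /= ?iI // b lerDl; exact: sumr_ge0.
apply: (@le_trans _ _ (sample_mean p (enum V) (fun S => 1 + (-1) * F S) set0)); last first.
  apply: ler_sample_mean => // S; rewrite mulN1r; apply: ler1B_indicator.
    by rewrite /F !addr_ge0 // ler0n.
  have F1S : 0 <= F1 S by rewrite ler0n.
  have F2S : 0 <= F2 S by rewrite ler0n.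
  have F3S := F3_ge0 M1 S; have F4S := F3_ge0 M2 S.
  apply: contraNT; rewrite -ltNge => lt1.
  have h : F1 S < 1 /\ F2 S < 1 /\ F3 M1 S < 1 /\ F3 M2 S < 1.
    by move: lt1; rewrite /F; lra.
  case: h => [l1 [l2 [l3 l4]]]; apply: good_sample_of_not_bad.
  - by move: l1; rewrite /F1; case: (_ <= _) => //; rewrite ltxx.
  - by move: l2; rewrite /F2; case: (_ <= _) => //; rewrite ltxx.
  - move=> I iI I0; apply/negP => b.
    by move: l3; rewrite ltNge (F3_ge1 _ _ I).
  - move=> I iI I0; apply/negP => b.
    by move: l4; rewrite ltNge (F3_ge1 _ _ I).
rewrite sample_meanD sample_mean_const sample_meanZ /F !sample_meanD.
have sumu : \sum_v u v <= B * r%:R by rewrite -mulr_sumr ler_wpM2l // ltW.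
have r1 : 1 <= r%:R :> R by rewrite ler1n.
have leq1 : sample_mean p (enum V) F1 set0 <= q.
  apply: le_trans (card_tail u_ge0 sumu) _.
  rewrite /q ler_expR lerN2 ler_wpM2l ?(ltW B_gt0) //.
  by apply: le_trans r1; nra.
have leq2 : sample_mean p (enum V) F2 set0 <= q.
  apply: (le_trans (weight_lower_tail u_ge0 (b := B * r%:R) (e := eps) _ _)).
  - by rewrite ltW.
  - by rewrite sumu andbT mulrCA -mulr_sumr ler_wpM2l ?(ltW B_gt0).
  rewrite /q ler_expR lerN2 -mulrA ler_wpM2l ?(ltW B_gt0) //.
  have eps2 : 0 <= eps ^+ 2 by rewrite exprn_ge0 // ltW.
  have : 0 <= (r%:R - 1) * eps ^+ 2 by rewrite mulr_ge0 ?subr_ge0.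
  by lra.
have leq3 := bad_spans_mean x1; have leq4 := bad_spans_mean x2.
have leq5 := nq_le.
have q0 : 0 < q := expR_gt0 _.
(* The two global events cost 2q <= nq and the spans 4nq, in total 5nq, below n^-d. *)
have : q * 2 <= n%:R * q by rewrite mulrC ler_wpM2r ?ler_nat // ltW.
have : 0 <= (n%:R ^+ d)^-1 :> R by rewrite invr_ge0 exprn_ge0.
rewrite -/(F3 M1) -/(F3 M2) in leq3 leq4; lra.
Qed.

End SparsifiedIntersection.

(** * The program *)

(** Real register 2 duplicates the counter in natural register 1, as the machine cannot convert
    naturals to reals; real register 1 holds the constant 1. *)
Definition harmonic_loop : cmd :=
  While (NLt 1 0)
    (Seq (RArith Add 2 2 1)
    (Seq (RArith Div 4 1 2)
    (Seq (RArith Add 3 3 4)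
         (NSucc 1)))).

Definition sample_loop : cmd :=
  While (NLt 1 0)
    (Seq (RLoad 4 1)
    (Seq (RArith Mul 4 3 4)
    (Seq (Flip 2 4)
    (Seq (NStore 1 2)
         (NSucc 1))))).

(* Real register 3 receives [c * H_n / eps ^ 2], where the harmonic number
   [H_n] stands in for [ln n], which the machine cannot compute. *)
Definition sparsify (c : nat) : cmd :=
  Seq (RConst 1 1)
    (If (RLt 0 1)
      (Seq harmonic_loop
      (Seq (RConst 4 c)
      (Seq (RArith Mul 3 4 3)
      (Seq (RArith Div 3 3 0)
      (Seq (RArith Div 3 3 0)
      (Seq (NConst 1 0)
           sample_loop))))))
      Skip).

Definition harmonic_number (R : fieldType) n : R := \sum_(i < n) i.+1%:R^-1.

Section Run.
Variable R : realFieldType.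
Implicit Types (s : state R) (E : pred (state R)) (k : seq cmd).

Lemma halt_prob_cons t c k s E :
  halt_prob t.+1 (c :: k) s E = \sum_(o <- step c k s) o.1 * halt_prob t o.2.1 o.2.2 E.
Proof. by []. Qed.

Lemma halt_prob_nil t s E : halt_prob t [::] s E = (E s)%:R.
Proof. by case: t. Qed.

Arguments halt_prob : simpl never.

(** A round costs eight steps: the test, three [Seq] and four instructions. The final failing test
    takes one more. *)
Lemma harmonic_loop_run m i t k s E :
  nreg s 0 = (i + m)%N -> nreg s 1 = i -> rreg s 1 = 1 -> rreg s 2 = i%:R ->
  rreg s 3 = harmonic_number R i ->
  exists s', [/\ nreg s' 0 = (i + m)%N, rreg s' 0 = rreg s 0,
    rreg s' 3 = harmonic_number R (i + m), nmem s' = nmem s & rmem s' = rmem s] /\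
  halt_prob (8 * m + t.+1) (harmonic_loop :: k) s E = halt_prob t k s' E.
Proof.
elim: m i s => [|m IHm] i s n0 n1 r1 r2 r3.
  exists s; rewrite addn0 in n0 *; split=> //.
  by rewrite muln0 add0n /harmonic_loop halt_prob_cons big_seq1 mul1r /= n0 n1 ltnn.
rewrite mulnS /harmonic_loop /= !addSn halt_prob_cons big_seq1 mul1r /=.
rewrite n0 n1 -addSnnS leq_addr /=.
do 7 rewrite halt_prob_cons big_seq1 mul1r /=.
set s1 := set_nreg _ _ _.
have [||||| s' [[e1 e2 e3 e4 e5] ->]] := IHm i.+1 s1; rewrite /s1 /=.
- by rewrite n0 addSnnS.
- by rewrite n1.
- by [].
- by rewrite r2 r1 -natr1.
- by rewrite r3 r2 r1 /harmonic_number big_ord_recr /= natr1 div1r.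
by exists s'.
Qed.

Section Sample.
Variables (V : finType) (x : V -> R) (B : R) (f : pred {set V}).
Let p v := clamp (B * x v).

(** The two outcomes of [Flip] are the two branches of [sample_mean]. Cells of elements still to
    come are zero, so the output so far is the accumulator. A round costs ten steps. *)
Lemma sample_loop_run l i t s :
  drop i (enum V) = l -> nreg s 0 = #|V| -> nreg s 1 = i -> rreg s 3 = B ->
  rmem s = nth 0 [seq x v | v <- enum V] ->
  (forall v, v \in l -> nmem s (enum_rank v) = 0%N) ->
  halt_prob (10 * size l + t.+1) [:: sample_loop] s (fun s => f (output V s))
  = sample_mean p l (fun S => (f S)%:R) (output V s).
Proof.
elim: l i s => [|v l IHl] i s dl n0 n1 r3 rm nm.
  rewrite muln0 add0n /sample_loop halt_prob_cons big_seq1 mul1r /= n0 n1.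
  have -> : (i < #|V|)%N = false.
    by apply/negbTE; rewrite -leqNgt cardE -subn_eq0 -size_drop dl.
  by rewrite halt_prob_nil.
have lti : (i < size (enum V))%N by rewrite -subn_gt0 -size_drop dl.
have ev : nth v (enum V) i = v by rewrite -[i]addn0 -nth_drop dl.
have dl' : drop i.+1 (enum V) = l by rewrite -addn1 addnC -drop_drop dl /= drop0.
have vl : v \notin l by have := drop_uniq i (enum_uniq V); rewrite dl => /andP[].
have rank w : (enum_rank w == i :> nat) = (w == v).
  rewrite -(nth_uniq v _ lti (enum_uniq V)) -?cardE ?ltn_ord //.
  by rewrite nth_enum_rank ev.
rewrite /= mulnS /sample_loop /= !addSn halt_prob_cons big_seq1 mul1r /= n0 n1 cardE lti.
do 5 rewrite halt_prob_cons big_seq1 mul1r /=.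
rewrite halt_prob_cons /= big_cons big_seq1 /= -/sample_loop.
have store T b E : halt_prob T.+3 [:: Seq (NStore 1 2) (NSucc 1); sample_loop] b E =
    halt_prob T [:: sample_loop]
      (set_nreg (set_nmem b (nreg b 1) (nreg b 2)) 1 (nreg b 1).+1) E.
  by do 3 rewrite halt_prob_cons big_seq1 mul1r /=.
rewrite !store /=.
rewrite rm n1 (nth_map v) // ev r3 -/(p v).
set s1 := set_nreg _ _ _; set s0 := set_nreg _ _ _.
have out1 : output V s1 = v |: output V s.
  by apply/setP => w; rewrite !inE /= rank; case: (w =P v).
have out0 : output V s0 = output V s.
  apply/setP => w; rewrite !inE /= rank; case: (w =P v) => // ->.
  by rewrite nm ?mem_head.
rewrite -out1 -[output V s]out0; congr (_ * _ + _ * _); apply: (IHl i.+1) => //.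
all: rewrite /s1 /s0 /= ?n0 ?n1 //.
all: move=> w wl; rewrite rank nm ?inE ?wl ?orbT // (_ : w == v = false) //.
all: by apply: contraNF vl => /eqP <-.
Qed.

End Sample.

Lemma sparsify_run (V : finType) (x : V -> R) (eps : R) (c : nat) (f : pred {set V}) :
  (1 < #|V|)%N ->
  let B := c%:R * harmonic_number R #|V| / eps / eps in
  halt_prob (26 * #|V|) [:: sparsify c] (input x eps) (fun s => f (output V s))
  = if eps < 1 then
      sample_mean (fun v => clamp (B * x v)) (enum V) (fun S => (f S)%:R) set0
    else (f set0)%:R.
Proof.
move=> n2 B; set n := #|V| in n2 B *.
(* The run takes at most 18n + 16 steps, which fits into 26n because n >= 2; t is the slack. *)
have [t ->] : exists t, (26 * n = (8 * n + (10 + (10 * n + t.+1)).+1).+4)%N.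
  exists (26 * n - (18 * n + 16))%N; lia.
have out0 s : nmem s = (fun=> 0%N) -> output V s = set0.
  by move=> e; apply/setP => v; rewrite !inE e.
rewrite /sparsify; do 3 rewrite halt_prob_cons big_seq1 mul1r /=.
case: ifP => eps1; last first.
  by rewrite halt_prob_cons big_seq1 mul1r /= halt_prob_nil out0.
rewrite halt_prob_cons big_seq1 mul1r /=.
set s1 := set_rreg _ _ _; set k := [:: _].
have [//|//|//|//||s' [[n0 r0 r3 nm rm] ->]] :=
  @harmonic_loop_run n 0 (10 + (10 * n + t.+1)) k s1 (fun s => f (output V s)).
  by rewrite /s1 /harmonic_number big_ord0.
rewrite /k; do 10 rewrite halt_prob_cons big_seq1 mul1r /=.
rewrite r0 r3 add0n {1}/n cardE.
rewrite (@sample_loop_run V x B f (enum V) 0) ?drop0 //=; last first.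
  by move=> v _; rewrite nm.
by rewrite out0.
Qed.
End Run.

(** * Harmonic numbers against the logarithm *)

Section Harmonic.
Variable R : realType.

Lemma ln_natS_le_harmonic n : ln (n.+1%:R : R) <= harmonic_number R n.
Proof.
elim: n => [|n IHn]; first by rewrite ln1 /harmonic_number big_ord0.
have n1 : 0 < n.+1%:R :> R by rewrite ltr0Sn.
rewrite /harmonic_number big_ord_recr /= -/(harmonic_number R n).
have -> : n.+2%:R = n.+1%:R * (1 + n.+1%:R^-1) :> R.
  by rewrite mulrDr mulr1 mulfV ?lt0r_neq0 // natr1.
have i0 : 0 < n.+1%:R^-1 :> R by rewrite invr_gt0.
rewrite lnM ?posrE ?addr_gt0 //.
by rewrite lerD // le_ln1Dx //; apply: lt_trans i0; rewrite oppr_lt0.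
Qed.

Lemma inv_natS_le_lnB n : n.+2%:R^-1 <= ln (n.+2%:R : R) - ln (n.+1%:R : R).
Proof.
have n1 : 0 < n.+1%:R :> R by rewrite ltr0Sn.
have n2 : 0 < n.+2%:R :> R by rewrite ltr0Sn.
have := @le_ln1Dx R (- n.+2%:R^-1).
have -> : 1 - n.+2%:R^-1 = n.+1%:R / n.+2%:R :> R.
  by rewrite -{1}(@mulfV _ (n.+2%:R : R)) ?lt0r_neq0 // -mulN1r -mulrDl -natr1 addrK.
rewrite ln_div ?posrE // => h.
by rewrite -lerN2 opprB; apply: h; rewrite ltrN2 invf_lt1 // ltr1n.
Qed.

(** H_n <= 1 + ln n by telescoping, and 1 <= 2 ln 2 <= 2 ln n. *)
Lemma harmonic_le n : (1 < n)%N -> harmonic_number R n <= 3 * ln (n%:R : R).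
Proof.
case: n => [|n] // n1.
have h : harmonic_number R n.+1 <= 1 + ln (n.+1%:R : R).
  elim: n {n1} => [|n IHn].
    by rewrite /harmonic_number big_ord1 ln1 invr1 addr0.
  rewrite /harmonic_number big_ord_recr /= -/(harmonic_number R n.+1).
  by apply: le_trans (lerD IHn (inv_natS_le_lnB n)) _; lra.
have : ln 2 <= ln (n.+1%:R : R) by rewrite ler_ln ?posrE ?ltr0Sn // ler_nat.
by have := inv_natS_le_lnB 0; rewrite ln1; lra.
Qed.

Lemma ln_le_harmonic n : (0 < n)%N -> ln (n%:R : R) <= harmonic_number R n.
Proof.
case: n => // n _; apply: le_trans (ln_natS_le_harmonic n) _.
by rewrite [leRHS]/harmonic_number big_ord_recr /= lerDl invr_ge0.
Qed.

End Harmonic.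

Theorem theorem8p4 (R : realType) (d : nat) :
  exists (p : cmd) (Ktime Ksize Keps : nat),
  forall (V : finType) (M1 M2 : matroid V) (eps : R) (x : V -> R),
  let n := #|V| in
  let r := common_rank M1 M2 [set: V] in
  let success (s : state R) :=
    let V' := output V s in
    (#|V'|%:R <= Ksize%:R * (r%:R / eps ^+ 2 * ln (n%:R : R)))
    && ((1 - Keps%:R * eps) * r%:R <= (common_rank M1 M2 V')%:R) in
  (1 < n)%N ->
  0 < eps ->
  matroid_polytope M1 x ->
  matroid_polytope M2 x ->
  (1 - eps) * r%:R <= \sum_(v : V) `|x v| ->
  halt_prob (Ktime * n) [:: p] (input x eps) predT = 1 /\
  1 - (n%:R ^+ d)^-1 <= halt_prob (Ktime * n) [:: p] (input x eps) success.
Proof.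
(* The 8 cancels the one in the upper tail, making the exponent (d + 4) H_n >= (d + 4) ln n. *)
pose c := (8 * (d + 4))%N.
(* In 12 c, a factor 4 comes from the bound on the sample size and a factor 3 from H_n <= 3 ln n. *)
exists (sparsify c), 26%N, (12 * c)%N, 3%N => V M1 M2 eps x n r success.
move=> n1 eps0 x1 x2 x_large.
have H1 := ln_le_harmonic R (ltnW n1); have H2 := harmonic_le R n1.
have ln0 : 0 < ln (n%:R : R) by rewrite ln_gt0 // ltr1n.
pose good (S : {set V}) :=
  (#|S|%:R <= (12 * c)%:R * (r%:R / eps ^+ 2 * ln (n%:R : R)))
  && ((1 - 3 * eps) * r%:R <= (common_rank M1 M2 S)%:R).
split.
  rewrite (sparsify_run x eps c xpredT n1).
  by case: ifP => _ //; rewrite sample_mean_const.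
rewrite (sparsify_run x eps c good n1); case: ifP => [eps1|]; last first.
  (* For eps >= 1 the program keeps nothing, which is enough as 1 - 3 eps < 0. *)
  move/negbT; rewrite -leNgt => eps1.
  have -> : good set0.
    rewrite /good cards0; apply/andP; split.
      by rewrite !mulr_ge0 ?ler0n ?invr_ge0 ?exprn_ge0 ?ltW.
    apply: (@le_trans _ _ 0); last exact: ler0n.
    by rewrite mulr_le0_ge0 ?ler0n //; lra.
  by rewrite gerBl invr_ge0 exprn_ge0.
set B := _ / eps / eps.
have eps_itv : 0 < eps <= 1 by rewrite eps0 ltW.
have c0 : 0 < c%:R :> R by rewrite ltr0n muln_gt0 addnS.
have B0 : 0 < B by rewrite /B !divr_gt0 ?mulr_gt0 //; lra.
have BE : B * eps ^+ 2 = c%:R * harmonic_number R n.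
  by rewrite /B; field; rewrite lt0r_neq0.
have B_large : n%:R ^+ (d + 4) <= expR (B * (eps ^+ 2 / 8)).
  have n0 : (n%:R : R) \is Num.pos by rewrite posrE ltr0n ltnW.
  rewrite -{1}(lnK n0) -expRM_natl ler_expR mulrA BE /c natrM.
  rewrite (_ : _ / 8 = (d + 4)%:R * harmonic_number R n); last by field.
  by rewrite ler_wpM2l.
have x_large' : (1 - eps) * r%:R <= \sum_v x v.
  apply: le_trans x_large _; apply: ler_sum => v _.
  by rewrite ger0_norm // (matroid_polytope_ge0 x1).
apply: (le_trans (sample_mean_good n1 eps_itv B0 x1 x2 x_large' B_large)).
apply: ler_sample_mean => [v|S]; first exact: clamp_itv.
apply: ler_nat_bool => /andP[le1 le2]; rewrite /good le2 andbT.
apply: le_trans le1 _; rewrite -(ler_pM2r (exprn_gt0 2 eps0)).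
rewrite [leLHS](_ : _ = 4 * r%:R * (B * eps ^+ 2)); last by rewrite -/r; ring.
rewrite BE [leRHS](_ : _ = 4 * r%:R * (c%:R * (3 * ln n%:R))).
  by rewrite ler_wpM2l ?mulr_ge0 // ler_wpM2l // ltW.
by rewrite natrM; field; rewrite lt0r_neq0.
Qed.
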